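(* Let $2 \le p \le q \le \infty$ and $n \le m \le 2^n$. Then \[ \mathrm{vb}_{n}(B_p^m,B_q^m) \gtrsim \sqrt{\min\Big\{ p, \log \Big(\frac{2m}{n}\Big) \Big\}} \cdot n^{1/2-1/p+1/q}. \]
   Context: $m,n$ are positive integers; $B_p^m := \{ \boldsymbol{x} \in \mathbb{R}^m \mid \|\boldsymbol{x}\|_p \leq 1\}$; $1/\infty=0$. $A\gtrsim B$ means $A\ge c\cdot B$ for a universal constant $c>0$ (independent of $m,n,p,q$). For symmetric convex bodies $P,Q\subseteq\mathbb{R}^m$, with $\|\boldsymbol{x}\|_Q=\min\{s\ge 0\mid \boldsymbol{x}\in sQ\}$, \[ \mathrm{vb}_{n}(P,Q) := \sup\Big\{ \min_{\boldsymbol{x} \in \{ -1,1\}^n} \Big\| \sum_{i=1}^n x_i\boldsymbol{v}_i \Big\|_Q \ \Big|\ \boldsymbol{v}_1,\ldots,\boldsymbol{v}_n \in P \Big\}. \] *)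

(* Defs.v *)
From HB Require Import structures.
From mathcomp Require Import all_boot all_order all_algebra.
From mathcomp Require Import all_classical all_reals all_analysis.

Set Implicit Arguments.
Unset Strict Implicit.
Unset Printing Implicit Defensive.

Import Order.TTheory GRing.Theory Num.Theory.

Local Open Scope classical_set_scope.
Local Open Scope ring_scope.

Section VectorBalancing.
Variable R : realType.

(* Only meant for 1 <= p <= +oo; the value at p = -oo is irrelevant. *)
Definition lpnorm (m : nat) (p : \bar R) (x : 'rV[R]_m) : R :=
  match p with
  | r%:E => (\sum_(j < m) `|x 0 j| `^ r) `^ r^-1
  | +oo%E => \big[Num.max/0]_(j < m) `|x 0 j|
  | -oo%E => 0
  end.

Definition lpball (m : nat) (p : \bar R) : set 'rV[R]_m :=
  [set x | lpnorm p x <= 1].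

(* When Q is a symmetric convex body the infimum is attained. *)
Definition gauge (m : nat) (Q : set 'rV[R]_m) (x : 'rV[R]_m) : R :=
  inf [set s : R | 0 <= s /\ exists2 y, Q y & x = s *: y].

(* A sign vector is encoded by booleans: x i stands for the sign (-1) ^+ x i. *)
Definition signed_sum (m n : nat) (v : 'I_n -> 'rV[R]_m)
    (x : {ffun 'I_n -> bool}) : 'rV[R]_m :=
  \sum_(i < n) (-1) ^+ x i *: v i.

(* The default element of the iterated min is itself the value at a sign
   vector, so this is the minimum over all sign vectors. *)
Definition min_signed_sum (m n : nat) (Q : set 'rV[R]_m)
    (v : 'I_n -> 'rV[R]_m) : R :=
  \big[Num.min/gauge Q (signed_sum v [ffun=> false])]_(x : {ffun 'I_n -> bool})
    gauge Q (signed_sum v x).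

(* When P and Q are symmetric convex bodies the set is nonempty and bounded,
   so this is its least upper bound. *)
Definition vb (m n : nat) (P Q : set 'rV[R]_m) : R :=
  sup [set min_signed_sum Q v | v in [set v : 'I_n -> 'rV[R]_m | forall i, P (v i)]].

End VectorBalancing.

Arguments lpball {R} m p.
Arguments vb {R m} n P Q.

(* Main.v *)
Require Import Defs.
From mathcomp Require Import all_boot all_order all_algebra.
From mathcomp Require Import all_classical all_reals all_analysis.
From mathcomp Require Import ring lra zify.

(* Fourth moments and a union bound over all 2^N sign vectors give 48 N sign
   rows h_j such that every x in {-1,1}^N has |<h_j, x>| >= sqrt (N / 2) for at
   least N of them.  Index k N vectors by pairs (a, b) and 48 N 2^k coordinates
   by pairs (j, s) with s in {-1,1}^k, the entry being s_a h_j(b).  Viewing a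
   sign vector as a k x N array X with rows X_a, coordinate (j, s) of the signed
   sum is sum_a s_a <h_j, X_a>; choosing s to match the signs, for at least N / 2
   values of j it is of order k sqrt N.  After rescaling the columns into the
   unit ball of l_p this yields k sqrt N n^(1/q - 1/p) up to a constant as long
   as k <= p, and it remains to take k of order min(p, log (2m/n)) and N of order
   n / k.  The power 2^(k/p) from the rescaling is bounded since k <= p, and the
   passage from N to n is free since 1/q - 1/p <= 0. *)

Import Order.TTheory GRing.Theory Num.Theory.

Local Open Scope ring_scope.

(** * Second and fourth moments of sign sums, and the choice of sign rows *)

Section Rademacher.
Context {R : realType} {I : finType}.
Implicit Types (h x : {ffun I -> bool}) (s : seq I).

Definition sgn_term h x (i : I) : R := (-1) ^+ h i * (-1) ^+ x i.
Definition sgn_dot h x : R := \sum_i sgn_term h x i.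

Lemma sgn_term_sqr h x i : sgn_term h x i ^+ 2 = 1.
Proof. by rewrite /sgn_term exprMn !sqrr_sign mulr1. Qed.

Definition flip_at (i : I) h : {ffun I -> bool} :=
  [ffun j => if j == i then ~~ h j else h j].

Lemma flip_atK i : involutive (flip_at i).
Proof. by move=> h; apply/ffunP => j; rewrite !ffunE; case: eqP => // _; rewrite negbK. Qed.

Lemma sgn_term_flip i h x : sgn_term (flip_at i h) x i = - sgn_term h x i.
Proof. by rewrite /sgn_term ffunE eqxx signrN mulNr. Qed.

Lemma sum_sgn_term_flip i s h x : i \notin s ->
  \sum_(j <- s) sgn_term (flip_at i h) x j = \sum_(j <- s) sgn_term h x j.
Proof.
move=> is_; apply: eq_big_seq => j js; rewrite /sgn_term ffunE.
by case: eqP js => // ->; rewrite (negbTE is_).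
Qed.

(** Pairing [h] with its flip at [i] plays the role of independence: odd powers of the term at [i]
    cancel within each pair. *)
Lemma sum_flip_at i (F : {ffun I -> bool} -> R) :
  \sum_h F h = 2^-1 * \sum_h (F h + F (flip_at i h)).
Proof.
have e : \sum_h F (flip_at i h) = \sum_h F h.
  by rewrite [RHS](reindex_inj (inv_inj (flip_atK i))).
by rewrite big_split /= e; lra.
Qed.

Lemma sumr_const_signs (c : R) : \sum_(h : {ffun I -> bool}) c = c * 2 ^+ #|I|.
Proof. by rewrite sumr_const card_ffun card_bool -[LHS]mulr_natr natrX. Qed.

Lemma sum_sgn_term_sqr x s : uniq s ->
  \sum_h (\sum_(i <- s) sgn_term h x i) ^+ 2 = (size s)%:R * 2 ^+ #|I|.
Proof.
elim: s => [|i s IH] /= => [_|/andP[is_ us]].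
  by rewrite big1 ?mul0r// => h _; rewrite big_nil expr0n.
rewrite (sum_flip_at i).
under eq_bigr => h _.
  rewrite !big_cons sum_sgn_term_flip // sgn_term_flip.
  rewrite (_ : _ + _ = 2 * (\sum_(j <- s) sgn_term h x j) ^+ 2 + 2 * sgn_term h x i ^+ 2); last by ring.
  rewrite sgn_term_sqr; over.
rewrite big_split /= -mulr_sumr IH // sumr_const_signs -[(size s).+1%:R]natr1.
by field.
Qed.

(** With [a] the sum over [s] and [b] the new sign, [(a + b)^4 + (a - b)^4 = 2 a^4 + 12 a^2 b^2 + 2
    b^4]. Hence the mean fourth power grows by at most [6 n + 1], while [3 n^2] grows by
    [6 n + 3]. *)
Lemma sum_sgn_term_pow4 x s : uniq s ->
  \sum_h (\sum_(i <- s) sgn_term h x i) ^+ 4 <= 3 * (size s)%:R ^+ 2 * 2 ^+ #|I|.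
Proof.
elim: s => [|i s IH] /= => [_|/andP[is_ us]].
  by rewrite big1 ?expr0n ?mulr0 ?mul0r// => h _; rewrite big_nil expr0n.
rewrite (sum_flip_at i).
under eq_bigr => h _.
  rewrite !big_cons sum_sgn_term_flip // sgn_term_flip.
  rewrite (_ : _ + _ = 2 * (\sum_(j <- s) sgn_term h x j) ^+ 4
     + 12 * (\sum_(j <- s) sgn_term h x j) ^+ 2 * sgn_term h x i ^+ 2
     + 2 * (sgn_term h x i ^+ 2) ^+ 2); last by ring.
  rewrite sgn_term_sqr expr1n !mulr1; over.
rewrite 2!big_split /= -!mulr_sumr sum_sgn_term_sqr // sumr_const_signs -[(size s).+1%:R]natr1.
have := IH us; set A := \sum_h _; set n := (size s)%:R; set E := 2 ^+ _ => hA.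
have E0 : 0 <= E by rewrite exprn_ge0.
have -> : 2^-1 * (2 * A + 12 * (n * E) + 2 * E) = A + 6 * n * E + E by field.
have -> : 3 * (n + 1) ^+ 2 * E = 3 * n ^+ 2 * E + 6 * n * E + 3 * E by ring.
lra.
Qed.

(** The mean of [sgn_dot h x ^+ 2] over [h] is [#|I|]; large means at least half of it. *)
Definition large_dot h x : bool := #|I|%:R / 2 <= sgn_dot h x ^+ 2.

Lemma sum_large_dot x : \sum_h (large_dot h x)%:R = #|[pred h | large_dot h x]|%:R :> R.
Proof. by rewrite -natr_sum -sum1_card [in RHS]big_mkcond. Qed.

(* Paley-Zygmund: average the pointwise bound
   [S ^ 2 <= N / 2 + 3 N 1_large + S ^ 4 / (12 N)]. *)
Lemma card_large_dot_ge x : (0 < #|I|)%N ->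
  2 ^+ #|I| <= 12 * #|[pred h | large_dot h x]|%:R :> R.
Proof.
move=> I0; set N : R := #|I|%:R; have N0 : 0 < N by rewrite ltr0n.
have pt h : sgn_dot h x ^+ 2 <=
    N / 2 + 3 * N * (large_dot h x)%:R + sgn_dot h x ^+ 4 / (12 * N).
  rewrite /large_dot -/N [_ ^+ 4](exprM _ 2 2).
  set S := sgn_dot h x ^+ 2.
  have S0 : 0 <= S by rewrite sqr_ge0.
  have S2 : 0 <= S ^+ 2 / (12 * N) by rewrite divr_ge0 ?sqr_ge0 // mulr_ge0 // ltW.
  case: (leP (N / 2) S) => hS /=; last by rewrite mulr0; lra.
  suff : S <= 3 * N + S ^+ 2 / (12 * N) by rewrite mulr1; lra.
  rewrite -subr_ge0 (_ : 3 * N + _ - _ = (S - 6 * N) ^+ 2 / (12 * N)); last by field; rewrite gt_eqF.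
  by rewrite divr_ge0 ?sqr_ge0 // mulr_ge0 // ltW.
have := ler_sum (index_enum _) (fun h (_ : true) => pt h).
have uI : uniq (index_enum I) by rewrite index_enum_uniq.
have szI : size (index_enum I) = #|I| by rewrite -sum1_size sum1_card.
rewrite {1}/sgn_dot sum_sgn_term_sqr // szI -/N !big_split /= sumr_const_signs.
rewrite -mulr_sumr sum_large_dot -mulr_suml.
have := sum_sgn_term_pow4 x _ uI; rewrite szI -/N -/(sgn_dot _ x).
set F := \sum_h _ ^+ 4; set g : R := #|_|%:R; set E := 2 ^+ _ => hF hg.
(* The fourth moment takes a quarter of [N * E] and the term [N / 2] takes half; the remaining
   quarter is at most [3 * N * g], whence the 12. *)
have hF' : F / (12 * N) <= N * E / 4.
  rewrite ler_pdivrMr; last by lra.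
  by apply: le_trans hF _; rewrite le_eqVlt; apply/orP; left; apply/eqP; field.
suff : N * E <= N * (12 * g) by rewrite ler_pM2l.
lra.
Qed.

(** At least one twelfth of all [h] have weight 1/2, so the mean weight is at most [1 - 1/24]. *)
Lemma sum_half_large x : (0 < #|I|)%N ->
  \sum_h (if large_dot h x then 2^-1 else 1) <= 23 / 24 * 2 ^+ #|I| :> R.
Proof.
move=> /(card_large_dot_ge x).
rewrite (eq_bigr (fun h => 1 - 2^-1 * (large_dot h x)%:R)); last first.
  by move=> h _; case: ifP => _ /=; lra.
rewrite big_split /= sumr_const_signs sumrN -mulr_sumr sum_large_dot.
lra.
Qed.

(* The constant 48 is chosen so that (23/24)^48 <= 1/4: the union bound over the
   2^N sign vectors costs a factor 2^N and must leave at most 2^-N. *)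
Lemma union_bound_le N : (2 ^+ N * (23 / 24) ^+ (48 * N) <= (2 ^+ N)^-1 :> R).
Proof.
have h48 : (23 / 24 : R) ^+ 48 <= 4^-1.
  (* The powers 4, 16, 48 are taken in stages and rounded up each time to keep the numerals
     small. *)
  have h4 : (23 / 24 : R) ^+ 4 <= 17 / 20 by rewrite !exprS expr0; lra.
  have h16 : ((23 / 24 : R) ^+ 4) ^+ 4 <= 53 / 100.
    by apply: le_trans (lerXn2r 4 _ _ h4) _; rewrite ?nnegrE ?exprn_ge0 //= ?mulr_ge0 // !exprS expr0; lra.
  rewrite (exprM _ 16 3) (exprM _ 4 4).
  by apply: le_trans (lerXn2r 3 _ _ h16) _; rewrite ?nnegrE ?exprn_ge0 //= ?mulr_ge0 // !exprS expr0; lra.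
rewrite -ler_pdivlMl ?exprn_gt0 // -invfM -exprMn exprM -exprVn.
apply: lerXn2r; rewrite ?nnegrE ?exprn_ge0 ?invr_ge0 ?mulr_ge0 //.
by apply: le_trans h48 _; lra.
Qed.

(* The weight [2 ^- #(large dot products)] has product form over the rows, so its
   average over all choices of rows factorizes. *)
Lemma exists_many_large_dots : (0 < #|I|)%N -> exists H : 'I_(48 * #|I|) -> {ffun I -> bool},
  forall x, (#|I| <= #|[pred j | large_dot (H j) x]|)%N.
Proof.
move=> I0; set N := #|I|.
pose f h x : R := if large_dot h x then 2^-1 else 1.
have tot : \sum_(H : {ffun 'I_(48 * N) -> {ffun I -> bool}}) \sum_x \prod_j f (H j) x
    <= \sum_(H : {ffun 'I_(48 * N) -> {ffun I -> bool}}) (2 ^+ N)^-1.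
  rewrite exchange_big /=.
  under eq_bigr do rewrite -(bigA_distr_bigA (fun _ h => f h _)) /= prodr_const card_ord.
  rewrite sumr_const card_ffun card_ord card_ffun card_bool -/N.
  apply: (@le_trans _ _ (\sum_(x : {ffun I -> bool}) (23 / 24 * 2 ^+ N) ^+ (48 * N))).
    apply: ler_sum => x _; apply: lerXn2r; last exact: sum_half_large.
    - by rewrite nnegrE; apply: sumr_ge0 => h _; rewrite /f; case: ifP.
    - by rewrite nnegrE mulr_ge0 // ?exprn_ge0.
  rewrite sumr_const_signs -/N -[leRHS]mulr_natr !natrX exprMn.
  have := union_bound_le N; set a := 2 ^+ N; set b := _ ^+ (48 * N); set d := a ^+ (48 * N) => hb.
  rewrite mulrAC [b * a]mulrC ler_wpM2r //; last by rewrite !exprn_ge0.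
(* Some [H] does no worse than the average. *)
have [H HH] : exists H : {ffun 'I_(48 * N) -> {ffun I -> bool}},
    \sum_x \prod_j f (H j) x <= (2 ^+ N)^-1.
  apply: contrapT => /forallNP nH; move: tot; rewrite leNgt => /negP; apply.
  apply: ltr_sum => [|H _]; last by rewrite ltNge; apply/negP.
  by apply/hasP; exists [ffun _ => [ffun _ => false]]; rewrite ?mem_index_enum.
exists H => x.
(* The sum over [x] bounds each of its nonnegative terms, and the term of [x] is [2^-1] to the
   number of large dot products. *)
have : \prod_j f (H j) x <= (2 ^+ N)^-1.
  apply: le_trans HH; rewrite (bigD1 x) //= lerDl sumr_ge0 // => y _.
  by apply: prodr_ge0 => j _; rewrite /f; case: ifP.
rewrite /f -big_mkcond /= prodr_const -exprVn.
rewrite ler_iXn2l //; try lra.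
Qed.
End Rademacher.

(** * Unit balls of l_p, the gauge, and lower bounds for [vb] *)

Section Balls.
Context {R : realType}.
Implicit Types (p q : \bar R) (r : R).

Lemma powR_le1 (a r : R) : 0 <= r -> 0 <= a <= 1 -> a `^ r <= 1.
Proof.
move=> r0 /andP[a0 a1]; have -> : 1 = (1 : R) `^ r by rewrite powR1.
by apply: ge0_ler_powR; rewrite ?nnegrE.
Qed.

Lemma lpball_finE m r (x : 'rV[R]_m) : 0 < r ->
  lpball m r%:E x <-> \sum_(j < m) `|x 0 j| `^ r <= 1.
Proof.
move=> r0; rewrite /lpball /= /lpnorm.
have S0 : 0 <= \sum_(j < m) `|x 0 j| `^ r by apply: sumr_ge0 => j _; exact: powR_ge0.
split=> h; last by apply: powR_le1; rewrite ?S0 // invr_ge0 ltW.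
rewrite (_ : \sum_(j < m) _ = ((\sum_(j < m) `|x 0 j| `^ r) `^ r^-1) `^ r); last first.
  by rewrite -powRrM mulVf ?powRr1 ?gt_eqF.
by apply: powR_le1; [exact: ltW | rewrite powR_ge0].
Qed.

Lemma lpball_pinftyE m (x : 'rV[R]_m) :
  lpball m +oo x <-> forall j, `|x 0 j| <= 1.
Proof.
rewrite /lpball /= /lpnorm; split=> [h j|h]; last exact: bigmax_le.
exact: le_trans (le_bigmax _ (fun j => `|x 0 j|) j) h.
Qed.

Lemma lpball_coord m p (x : 'rV[R]_m) j : (1 <= p)%E ->
  lpball m p x -> `|x 0 j| <= 1.
Proof.
case: p => [r|_|//]; last by move/lpball_pinftyE.
rewrite lee_fin => r1; have r0 : 0 < r by apply: lt_le_trans r1.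
move/(lpball_finE _ _ _ r0) => h; rewrite leNgt; apply/negP => xj.
have : `|x 0 j| `^ r <= 1.
  apply: le_trans h; rewrite (bigD1 j) //= lerDl sumr_ge0 // => i _; exact: powR_ge0.
rewrite leNgt => /negP; apply; have -> : 1 = (1 : R) `^ r by rewrite powR1.
apply: gt0_ltr_powR; rewrite ?nnegrE //.
Qed.

(** A crude dilation, enough to make the infimum in the gauge meaningful and the supremum in [vb]
    finite: a vector with entries at most [1/m] in absolute value lies in the ball for every
    [q >= 1]. *)
Lemma gauge_set_mem m q (x : 'rV[R]_m) (B : R) : (0 < m)%N -> (1 <= q)%E -> 0 < B ->
  (forall j, `|x 0 j| <= B) ->
  0 <= B * m%:R /\ exists2 y, lpball m q y & x = (B * m%:R) *: y.
Proof.
move=> m0 q1 B0 hx; have M0 : 0 < m%:R :> R by rewrite ltr0n.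
have s0 : 0 < B * m%:R by rewrite mulr_gt0.
split; first exact: ltW.
exists ((B * m%:R)^-1 *: x); last by rewrite scalerA divff ?scale1r // gt_eqF.
have hy j : `|((B * m%:R)^-1 *: x) 0 j| <= m%:R^-1.
  rewrite mxE normrM gtr0_norm ?invr_gt0 // invfM mulrAC ler_piMl ?invr_ge0 ?(ltW M0) //.
  by rewrite ler_pdivrMl // mulr1.
have m1 : m%:R^-1 <= 1 :> R by rewrite invf_le1 // ler1n.
case: q q1 => [r|_|//]; last by apply/lpball_pinftyE => j; exact: le_trans (hy j) m1.
rewrite lee_fin => r1; have r0 : 0 < r by apply: lt_le_trans r1.
apply/lpball_finE => //.
apply: (@le_trans _ _ (\sum_(j < m) m%:R^-1)).
  apply: ler_sum => j _; apply: (@le_trans _ _ ((m%:R^-1 : R) `^ r)).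
    by apply: ge0_ler_powR; rewrite ?nnegrE ?invr_ge0 // ltW.
  by rewrite -[leRHS]powRr1 ?invr_ge0 // ger_powR // invr_gt0 M0.
by rewrite sumr_const card_ord -[leLHS]mulr_natr mulVf ?gt_eqF.
Qed.

Lemma signed_sum_coord m n (v : 'I_n -> 'rV[R]_m) x j :
  signed_sum v x 0 j = \sum_(i < n) (-1) ^+ x i * v i 0 j.
Proof. by rewrite /signed_sum summxE; apply: eq_bigr => i _; rewrite mxE. Qed.

(** Lower bounds require a nonempty set under [inf] and a bounded one under [sup]; both follow since
    signed sums of [n] vectors of the ball have coordinates at most [n]. *)
Lemma vb_ge m n p q (v : 'I_n -> 'rV[R]_m) (t : R) :
  (0 < m)%N -> (0 < n)%N -> (1 <= p)%E -> (1 <= q)%E ->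
  (forall i, lpball m p (v i)) ->
  (forall x s y, 0 <= s -> lpball m q y -> signed_sum v x = s *: y -> t <= s) ->
  t <= vb n (lpball m p) (lpball m q).
Proof.
move=> m0 n0 p1 q1 hv ht.
have bnd (w : 'I_n -> 'rV[R]_m) x : (forall i, lpball m p (w i)) ->
    forall j, `|signed_sum w x 0 j| <= n%:R.
  move=> hw j; rewrite signed_sum_coord; apply: le_trans (ler_norm_sum _ _ _) _.
  rewrite -[n in leRHS]card_ord -sumr_const; apply: ler_sum => i _.
  by rewrite normrM normrX normrN1 expr1n mul1r; exact: lpball_coord p1 (hw i).
have nR : 0 < n%:R :> R by rewrite ltr0n.
have mem (w : 'I_n -> 'rV[R]_m) x : (forall i, lpball m p (w i)) -> _ :=
  fun hw => @gauge_set_mem m q _ _ m0 q1 nR (bnd w x hw).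
apply: (@le_trans _ _ (min_signed_sum (lpball m q) v)).
  apply: le_bigmin => [|x _]; apply: lb_le_inf; try (by eexists; exact: mem);
    by move=> s [s0 [y yq e]]; exact: ht s0 yq e.
apply: ub_le_sup; last by exists v.
exists (n%:R * m%:R) => _ [w hw <-].
(* The minimum is at most its default element, the value at the all-plus sign vector. *)
apply: (@le_trans _ _ (gauge (lpball m q) (signed_sum w [ffun=> false]))).
  exact: bigmin_le.
by apply: ge_inf; [exists 0 => s [] | exact: mem].
Qed.

(** The coordinates in [J] alone contribute [t * #|J|^(1/q)] to the l_q norm; for [q = +oo] the
    exponent is 0 and one coordinate suffices. *)
Lemma gauge_many_coords m q (x y : 'rV[R]_m) (s t : R) (J : {set 'I_m}) :
  (2%:E <= q)%E -> 0 <= s -> lpball m q y -> x = s *: y -> 0 < t -> (0 < #|J|)%N ->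
  (forall j, j \in J -> t <= `|x 0 j|) ->
  t * #|J|%:R `^ (fine q^-1%E) <= s.
Proof.
move=> q2 s0 yq e t0 J0 hJ.
have xE j : `|x 0 j| = s * `|y 0 j| by rewrite e mxE normrM ger0_norm.
case: q q2 yq => [r|_|//].
  rewrite lee_fin => r2; have r0 : 0 < r by apply: lt_le_trans r2.
  move/(lpball_finE _ _ _ r0) => h; rewrite fine_invr.
  have : #|J|%:R * t `^ r <= s `^ r.
    apply: (@le_trans _ _ (s `^ r * \sum_j `|y 0 j| `^ r)); last first.
      by rewrite ler_piMr // powR_ge0.
    rewrite mulr_sumr mulr_natl -sumr_const big_mkcond /=.
    apply: ler_sum => j _; rewrite -powRM // -xE; case: ifP => [jJ|_]; last exact: powR_ge0.
    by apply: ge0_ler_powR; rewrite ?nnegrE ?hJ // ltW.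
  move=> hh; have : (#|J|%:R * t `^ r) `^ r^-1 <= (s `^ r) `^ r^-1.
    by apply: ge0_ler_powR; rewrite ?nnegrE ?mulr_ge0 ?powR_ge0 ?invr_ge0 // ltW.
  rewrite powRM ?powR_ge0 // -!powRrM divff ?gt_eqF // !powRr1 ?(ltW t0) //.
  by rewrite mulrC.
move/lpball_pinftyE => h; rewrite invey /= powRr0 mulr1.
have [j jJ] := card_gt0P J0; apply: le_trans (hJ j jJ) _.
by rewrite xE ler_piMr.
Qed.

(* A matrix with entries in [-1, 1], rescaled by [#|T| ^ (- 1/p)], has its
   columns in the unit ball of l_p; zero padding makes room for [n] and [m]. *)
Lemma vb_ge_matrix (I T : finType) m n p q (A : T -> I -> R) (t : R) (J : nat) :
  (2%:E <= p)%E -> (2%:E <= q)%E -> (0 < #|I| <= n)%N -> (0 < #|T| <= m)%N ->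
  (forall a i, `|A a i| <= 1) -> 0 < t -> (0 < J)%N ->
  (forall x : {ffun I -> bool},
    (J <= #|[pred a | (t <= `|\sum_i (-1) ^+ x i * A a i|)%R]|)%N) ->
  #|T|%:R `^ (- fine p^-1%E) * (t * J%:R `^ (fine q^-1%E)) <=
    vb n (lpball m p) (lpball m q).
Proof.
move=> p2 q2 /andP[I0 In] /andP[T0 Tm] A1 t0 J0 hA.
set mu := _ `^ (- _).
have TR : 0 < #|T|%:R :> R by rewrite ltr0n.
have mu0 : 0 < mu by rewrite powR_gt0.
have q1 : (1 <= q)%E by apply: le_trans q2; rewrite lee_fin; lra.
have p1 : (1 <= p)%E by apply: le_trans p2; rewrite lee_fin; lra.
pose e (a : T) : 'I_m := widen_ord Tm (enum_rank a).
pose g (i : I) : 'I_n := widen_ord In (enum_rank i).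
have einj : injective e by move=> a b /(congr1 val) /= /val_inj /enum_rank_inj.
have ginj : injective g by move=> a b /(congr1 val) /= /val_inj /enum_rank_inj.
(* Partial inverses of the two embeddings; [None] marks the zero padding. *)
pose e' j := [pick a | e a == j]; pose g' i := [pick b | g b == i].
have eK a : e' (e a) = Some a.
  by rewrite /e'; case: pickP => [b /eqP/einj->//|/(_ a)]; rewrite eqxx.
have gK a : g' (g a) = Some a.
  by rewrite /g'; case: pickP => [b /eqP/ginj->//|/(_ a)]; rewrite eqxx.
pose v i : 'rV[R]_m := \row_j
  if g' i is Some b then if e' j is Some a then mu * A a b else 0 else 0.
apply: (@vb_ge _ _ _ _ v) => //; try lia.
  move=> i.
  have vj j : `|v i 0 j| <= if e' j is Some _ then mu else 0.
    rewrite mxE; case: (g' i) (e' j) => [b|] [a|]; rewrite ?normr0 ?(ltW mu0) //.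
    by rewrite normrM gtr0_norm // ler_piMr // ltW.
  case: p p2 p1 @mu mu0 @v vj => [r|_|//].
    rewrite lee_fin => r2 _ mu mu0 v vj; have r0 : 0 < r by apply: lt_le_trans r2.
    apply/lpball_finE => //.
    (* At most [#|T|] coordinates are nonzero, and [mu ^ r = 1 / #|T|]. *)
    apply: (@le_trans _ _ (\sum_(j < m | e' j) mu `^ r)).
      rewrite [leRHS]big_mkcond; apply: ler_sum => j _; have := vj j.
      case: (e' j) => [a|] h /=; first by apply: ge0_ler_powR; rewrite ?nnegrE // ltW.
      by have -> : `|v i 0 j| = 0; [apply/eqP; rewrite eq_le h normr_ge0 | rewrite powR0 // gt_eqF].
    rewrite (reindex_omap e e') /=; last first.
      move=> j; rewrite /e'; case: pickP => [a /eqP/= ->//|//].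
    rewrite (eq_bigl predT) => [|a]; last by rewrite eK eqxx.
    rewrite sumr_const -[leLHS]mulr_natl /mu fine_invr -powRrM mulNr mulVf ?gt_eqF //.
    by rewrite powRN powRr1 ?(ltW TR) // divff ?gt_eqF.
  move=> _ mu mu0 v vj; apply/lpball_pinftyE => j; apply: le_trans (vj j) _.
  by rewrite /mu invey /= oppr0 powRr0; case: (e' j).
move=> x s y s0 yq exy.
(* Vectors outside the range of [g] vanish, so only the signs on [I] matter. *)
pose x' : {ffun I -> bool} := [ffun i => x (g i)].
have xe a : signed_sum v x 0 (e a) = mu * \sum_i (-1) ^+ x' i * A a i.
  rewrite signed_sum_coord (bigID (fun i => g' i : bool)) /= [X in _ + X]big1 ?addr0; last first.
    by move=> i; rewrite mxE; case: (g' i) => //; rewrite mulr0.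
  rewrite (reindex_omap g g') /=; last first.
    by move=> j; rewrite /g'; case: pickP => [b /eqP/= ->//|//].
  rewrite (eq_bigl predT) => [|i]; last by rewrite gK eqxx.
  by rewrite mulr_sumr; apply: eq_bigr => i _; rewrite mxE gK eK ffunE mulrCA.
have hJ := hA x'.
set P := [pred a | _] in hJ.
have cJ : #|[set e a | a in P]| = #|P| by rewrite card_imset.
have := @gauge_many_coords m q _ _ s (mu * t) [set e a | a in P] q2 s0 yq exy.
rewrite cJ => /(_ (mulr_gt0 mu0 t0) (leq_trans J0 hJ)) H.
apply: le_trans (H _); last first.
  move=> _ /imsetP[a aP ->]; rewrite xe normrM gtr0_norm // ler_pM2l //.
rewrite -mulrA ler_pM2l // ler_pM2l //.
apply: ge0_ler_powR; rewrite ?nnegrE ?ler_nat //.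
by case: (q) q2 => [r|_|//]; rewrite ?invey //= ?fine_invr lee_fin => r2; rewrite invr_ge0; lra.
Qed.
End Balls.

(** * The block matrix and the bound it gives *)

Lemma exists_block_matrix (R : realType) (k N : nat) : (0 < k)%N -> (0 < N)%N ->
  exists A : 'I_(48 * N) * {ffun 'I_k -> bool} -> 'I_k * 'I_N -> R,
    (forall t i, `|A t i| <= 1) /\
    forall x : {ffun 'I_k * 'I_N -> bool},
      (N <= 2 * #|[pred t | (k%:R / 96 * Num.sqrt (N%:R / 2) <=
                            `|\sum_i (-1) ^+ x i * A t i|)%R]|)%N.
Proof.
move=> k0 N0.
have [H hH] : exists H : 'I_(48 * N) -> {ffun 'I_N -> bool},
    forall x, (N <= #|[pred j | @large_dot R _ (H j) x]|)%N.
  by have := @exists_many_large_dots R 'I_N; rewrite card_ord; exact.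
exists (fun (t : 'I_(48 * N) * {ffun 'I_k -> bool}) (i : 'I_k * 'I_N) =>
  (-1) ^+ t.2 i.1 * (-1) ^+ H t.1 i.2); split.
  by move=> t i; rewrite normrM !normrX normrN1 !expr1n mulr1.
move=> x; set th : R := _ * _; set P := [pred t | _].
pose X a : {ffun 'I_N -> bool} := [ffun b => x (a, b)].
pose d j a : R := sgn_dot (H j) (X a).
pose g j := (\sum_(a < k) (@large_dot R _ (H j) (X a) : nat))%N.
(* The pattern [s j] matches the signs, so coordinate [(j, s j)] of the signed sum is the sum of all
   [|d j a|]. *)
pose s j : {ffun 'I_k -> bool} := [ffun a => d j a < 0].
have gk j : (g j <= k)%N.
  by rewrite -[leqRHS]card_ord -sum1_card; apply: leq_sum => a _; case: large_dot.
have gsum : (k * N <= \sum_j g j)%N.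
  rewrite exchange_big /= -[k in leqLHS]card_ord -sum_nat_const; apply: leq_sum => a _.
  by apply: leq_trans (hH (X a)) _; rewrite -sum1_card big_mkcond.
(* The mean of [g] over the [48 N] values of [j] is at least [k / 48]; [G] keeps those reaching half
   of that. *)
pose G := [set j | (k <= 96 * g j)%N].
have valE j : \sum_i (-1) ^+ x i * ((-1) ^+ s j i.1 * (-1) ^+ H j i.2) = \sum_(a < k) `|d j a|.
  under [RHS]eq_bigr => a _.
    rewrite normrEsign /d /sgn_dot mulr_sumr; over.
  rewrite pair_big /=; apply: eq_bigr => -[a b] _ /=.
  by rewrite /sgn_term !ffunE /d; ring.
have hG j : j \in G -> P (j, s j).
  rewrite inE => hj; rewrite /P /= valE ger0_norm ?sumr_ge0 //.
  apply: (@le_trans _ _ ((g j)%:R * Num.sqrt (N%:R / 2))).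
    rewrite ler_wpM2r ?sqrtr_ge0 // ler_pdivrMr // -natrM ler_nat; lia.
  rewrite natr_sum mulr_suml; apply: ler_sum => a _.
  rewrite /large_dot card_ord -/(d j a); case: (leP (N%:R / 2) (d j a ^+ 2)) => /= h; last by rewrite mul0r.
  by rewrite mul1r -sqrtr_sqr ler_wsqrtr.
have GP : (#|G| <= #|P|)%N.
  rewrite -(@card_imset _ _ (fun j => (j, s j))) => [|i j [] //].
  by apply/subset_leq_card/fintype.subsetP => _ /imsetP[j jG ->]; exact: hG.
apply: leq_trans (leq_mul (leqnn 2) GP).
(* Each [j] in [G] contributes at most [k], any other at most [k / 96]; against a total of at least
   [k N] this leaves [#|G| >= N / 2]. *)
have gub : (96 * \sum_j g j <= 96 * (#|G| * k) + 48 * N * k)%N.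
  have : (\sum_j (96 * g j) <= \sum_j ((if j \in G then 96 * k else 0) + k))%N.
    by apply: leq_sum => j _; have := gk j; case: ifP => [_|]; rewrite ?inE; lia.
  by rewrite -big_distrr /= big_split /= -big_mkcond /= !sum_nat_const card_ord mulnCA.
rewrite -(leq_pmul2r k0); move: gsum gub; move: (\sum_j g j)%N #|G| => S c; nia.
Qed.

(** Here [1/oo = 0]; the last bound is what keeps [2 ^ (k/p)] below 2. *)
Lemma fine_inv_bounds (R : realType) (p q : \bar R) (k : nat) :
  (2%:E <= p)%E -> (p <= q)%E -> (k%:R%:E <= p)%E ->
  [/\ 0 <= fine q^-1%E, fine q^-1%E <= fine p^-1%E, fine p^-1%E <= 1 &
      k%:R * fine p^-1%E <= 1].
Proof.
case: p => [r| |]; case: q => [s| |] //; rewrite ?invey ?fine_invr ?lee_fin /= ?mulr0 //.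
- move=> r2 rs kr; have r0 : 0 < r by lra.
  split; rewrite ?invr_ge0 ?invf_le1 ?ler_pdivrMr ?mul1r ?lef_pV2 ?posrE //; lra.
- move=> r2 _ kr; have r0 : 0 < r by lra.
  split; rewrite ?invr_ge0 ?invf_le1 ?ler_pdivrMr ?mul1r //; lra.
Qed.

(** In the constant, 48 and one factor 2 bound [48 ^ (1/p)] and [2 ^ (k/p)], 96 is the loss in the
    threshold, and the other two factors 2 pay for [sqrt (N / 2)] and for [uphalf N] in place of
    [N]. *)
Lemma vb_ge_block (R : realType) (m n k N : nat) (p q : \bar R) :
  (2%:E <= p)%E -> (p <= q)%E -> (0 < k)%N -> (0 < N)%N ->
  (k%:R%:E <= p)%E -> (k * N <= n)%N -> (48 * N * 2 ^ k <= m)%N ->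
  (48 * 2 * 2 * 96 * 2)^-1 * (k%:R * Num.sqrt N%:R * n%:R `^ (fine q^-1%E - fine p^-1%E)) <=
    vb n (lpball m p) (lpball m q) :> R.
Proof.
move=> p2 pq k0 N0 kp kNn hm.
have J0 : (0 < uphalf N)%N by lia.
have J_le c : (N <= 2 * c)%N -> (uphalf N <= c)%N by lia.
have le_J : (N <= uphalf N * 2)%N by lia.
have n0 : (0 < n)%N by apply: leq_trans kNn; rewrite muln_gt0 k0.
have q2 := le_trans p2 pq.
have [A [A1 hA]] := @exists_block_matrix R k N k0 N0.
have NR : 0 < N%:R :> R by rewrite ltr0n.
have kR : 0 < k%:R :> R by rewrite ltr0n.
have sq0 : 0 < Num.sqrt (N%:R / 2) :> R by rewrite sqrtr_gt0 divr_gt0.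
have cT : #|{: 'I_(48 * N) * {ffun 'I_k -> bool}}| = (48 * N * 2 ^ k)%N.
  by rewrite card_prod card_ord card_ffun card_bool card_ord.
have cI : #|{: 'I_k * 'I_N}| = (k * N)%N by rewrite card_prod !card_ord.
have e2 : (0 < 2 ^ k)%N by rewrite expn_gt0.
have := @vb_ge_matrix R _ _ m n p q A (k%:R / 96 * Num.sqrt (N%:R / 2)) (uphalf N) p2 q2.
rewrite cT cI => /(_ _ _ A1) H.
apply: le_trans (H _ _ _ _ _); rewrite ?kNn ?hm ?muln_gt0 ?k0 ?N0 ?e2 ?mulr_gt0 ?divr_gt0 //; last first.
  by move=> x; exact: J_le (hA x).
clear A A1 hA H cT cI.
have [qe0 qp p1 kpe] := fine_inv_bounds _ _ _ _ p2 pq kp.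
set pe := fine p^-1%E in qp p1 kpe *; set qe := fine q^-1%E in qe0 qp *.
have pe0 := le_trans qe0 qp.
have a1 : 48^-1 <= 48 `^ (- pe) :> R.
  by rewrite powRN lef_pV2 ?posrE ?powR_gt0 // -[leRHS]powRr1 // ler_powR //; lra.
have a2 : 2^-1 <= (2 ^ k)%:R `^ (- pe) :> R.
  rewrite powRN lef_pV2 ?posrE ?powR_gt0 ?ltr0n //.
  by rewrite natrX -powR_mulrn // -powRrM -[leRHS]powRr1 // ler_powR //; lra.
have a3 : N%:R `^ qe / 2 <= (uphalf N)%:R `^ qe :> R.
  apply: (@le_trans _ _ ((N%:R / 2) `^ qe)); last first.
    by apply: ge0_ler_powR; rewrite ?nnegrE ?divr_ge0 // ler_pdivrMr // -natrM ler_nat.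
  rewrite powRM ?invr_ge0 // ler_pM2l ?powR_gt0 //.
  rewrite -[leLHS]powRr1 ?invr_ge0 // ger_powR //; lra.
have a4 : Num.sqrt N%:R / 2 <= Num.sqrt (N%:R / 2) :> R.
  rewrite ler_pdivrMr // -[leRHS]ger0_norm ?mulr_ge0 ?sqrtr_ge0 // -sqrtr_sqr.
  by apply: ler_wsqrtr; rewrite exprMn sqr_sqrtr ?divr_ge0 //; lra.
(* The exponent is at most 0, so passing from [N] to the larger [n] can only decrease the power. *)
have a5 : n%:R `^ (qe - pe) <= N%:R `^ qe * N%:R `^ (- pe) :> R.
  rewrite -powRD ?(gt_eqF NR) ?implybT // -(opprB pe qe) !powRN.
  have Nn : (N <= n)%N by apply: leq_trans kNn; rewrite leq_pmull.
  have nR : 0 < n%:R :> R by rewrite ltr0n.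
  rewrite lef_pV2 ?posrE ?powR_gt0 //.
  by apply: ge0_ler_powR; rewrite ?nnegrE ?ler_nat ?subr_ge0.
rewrite natrM natrM !powRM //.
set x1 := 48 `^ _ in a1 *; set x2 := (2 ^ k)%:R `^ _ in a2 *.
set x3 := (uphalf N)%:R `^ _ in a3 *; set x4 := Num.sqrt (N%:R / 2) in a4 *.
set x5 := n%:R `^ _ in a5 *; set y := N%:R `^ qe in a3 a5; set z := N%:R `^ (- pe) in a5 *.
set w := Num.sqrt N%:R in a4 *.
have z0 : 0 <= z by exact: powR_ge0.
have y0 : 0 <= y by exact: powR_ge0.
have w0 : 0 <= w by exact: sqrtr_ge0.
apply: (@le_trans _ _ ((48^-1 * z * 2^-1) * (k%:R / 96 * (w / 2) * (y / 2)))).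
  rewrite [leRHS](_ : _ = (48 * 2 * 2 * 96 * 2)^-1 * (k%:R * w * (y * z))); last by field.
  by rewrite ler_pM2l ?invr_gt0 ?ler_wpM2l ?mulr_ge0 //; lra.
by apply: ler_pM; rewrite ?mulr_ge0 //; apply: ler_pM; rewrite ?mulr_ge0 ?divr_ge0 ?invr_ge0 //;
  apply: ler_pM; rewrite ?mulr_ge0 ?divr_ge0 ?invr_ge0.
Qed.

(** A single unit coordinate vector, padded by zero vectors, suffices; this covers [n < 96]. *)
Lemma vb_ge1 (R : realType) (m n : nat) (p q : \bar R) :
  (2%:E <= p)%E -> (2%:E <= q)%E -> (0 < n)%N -> (0 < m)%N ->
  1 <= vb n (lpball m p) (lpball m q).
Proof.
move=> p2 q2 n0 m0.
have := @vb_ge_matrix R unit unit m n p q (fun _ _ => 1) 1 1 p2 q2.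
rewrite card_unit !powR1 !mul1r; apply; rewrite ?normr1 //.
move=> x; apply/card_gt0P; exists tt; rewrite inE.
rewrite (bigD1 tt) //= big1 ?addr0 => [|[]//].
by rewrite mulr1 normrX normrN1 expr1n.
Qed.

(** * The choice of the block size and the conclusion *)

Lemma exists_block_size (R : realType) (m n : nat) (p : \bar R) :
  (0 < n)%N -> (n <= m)%N -> (2%:E <= p)%E ->
  exists K : nat, [/\ (0 < K)%N, (K%:R%:E <= p)%E, (2 ^ K * n <= 2 * m)%N &
    fine (Order.min p (ln (2 * m%:R / n%:R))%:E) <= K.+1%:R].
Proof.
move=> n0 nm p2.
pose P K := (K%:R%:E <= p)%E && (2 ^ K * n <= 2 * m)%N.
have exP : exists K, P K.
  exists 1%N; rewrite /P expn1 leq_mul2l nm andbT.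
  by apply: le_trans p2; rewrite lee_fin; lra.
have ubP K : P K -> (K <= 2 * m)%N.
  move=> /andP[_ h]; apply: leq_trans h; apply: leq_trans (ltnW (ltn_expl K (ltnSn 1))) _.
  by rewrite leq_pmulr.
case: (ex_maxnP exP ubP) => K /andP[Kp Km] Kmax; exists K; split => //.
  apply: Kmax; rewrite /P expn1 leq_mul2l nm andbT.
  by apply: le_trans p2; rewrite lee_fin; lra.
(* By maximality [K + 1] violates one of the two conditions; either way the minimum is at most
   [K + 1], in the second case because [ln 2 <= 1]. *)
have : ~~ P K.+1 by apply/negP => /Kmax; rewrite ltnn.
have nR : 0 < n%:R :> R by rewrite ltr0n.
have mR : 0 < m%:R :> R by rewrite ltr0n (leq_trans n0).
rewrite /P negb_and -ltNge -ltnNge => /orP[pK|mK].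
  case: p p2 pK {Kp Kmax P exP ubP} => [r|//|//]; rewrite !lte_fin => _ rK.
  by rewrite -EFin_min /= ge_min (ltW rK).
have hl : ln (2 * m%:R / n%:R) <= K.+1%:R :> R.
  have : ln (2 * m%:R / n%:R) <= ln (2 ^+ K.+1) :> R.
    rewrite ler_ln ?posrE ?divr_gt0 ?mulr_gt0 ?exprn_gt0 //.
    by rewrite ler_pdivrMr // -natrX -!natrM ler_nat ltnW.
  move=> /le_trans; apply; rewrite lnXn // -[leLHS]mulr_natr ler_piMl //.
  by have := @le_ln1Dx R 1; rewrite (_ : 1 + 1 = 2) //; apply; lra.
case: p {p2 Kp Kmax P exP ubP} => [r| |]; first by rewrite -EFin_min /= ge_min hl orbT.
  by rewrite minye.
by rewrite minNye.
Qed.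

Lemma vb_large (R : realType) (m n K : nat) (p q : \bar R) :
  (96 <= n)%N -> (n <= m)%N -> (m <= 2 ^ n)%N -> (2%:E <= p)%E -> (p <= q)%E ->
  (0 < K)%N -> (K%:R%:E <= p)%E -> (2 ^ K * n <= 2 * m)%N ->
  (48 * 2 * 2 * 96 * 2 * 192)^-1 *
    (Num.sqrt (K.+1%:R * n%:R) * n%:R `^ (fine q^-1%E - fine p^-1%E)) <=
    vb n (lpball m p) (lpball m q) :> R.
Proof.
move=> n96 nm mn p2 pq K0 Kp Km.
(* Here [m <= 2 ^ n] enters: [2 ^ K * 2 <= 2 ^ K * n <= 2 * m <= 2 * 2 ^ n]. *)
have Kn : (K <= n)%N.
  rewrite -(@leq_exp2l 2) // -(@leq_pmul2r 2) // mulnC [leqRHS]mulnC.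
  apply: leq_trans (leq_mul (leqnn 2) mn); apply: leq_trans Km.
  by rewrite mulnC leq_mul2l (leq_trans _ n96) ?orbT.
(* Dividing by 96 gives [96 * k <= n], so [N > 0]; the 96 in [N] gives [48 * N <= n / 2], so
   [48 * N * 2 ^ k <= 2 ^ K * n / 2 <= m]. The maximum keeps [k] positive. *)
pose k := maxn 1 (K %/ 96); pose N := (n %/ (96 * k))%N.
have k0 : (0 < k)%N by rewrite leq_maxl.
have kK : (k <= K)%N by rewrite geq_max K0 leq_div.
have Kk : (K.+1 <= 192 * k)%N.
  by have := ltn_ceil K (isT : 0 < 96)%N; have := leq_maxr 1 (K %/ 96); rewrite -/k; lia.
have k96 : (96 * k <= n)%N.
  by rewrite maxnMr geq_max muln1 n96 (leq_trans _ Kn) // mulnC leq_trunc_div.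
have N0 : (0 < N)%N by rewrite divn_gt0 // muln_gt0.
have Nn : (96 * k * N <= n)%N by rewrite mulnC leq_trunc_div.
have nN : (n <= 192 * k * N)%N.
  have : (n < N.+1 * (96 * k))%N by rewrite ltn_ceil // muln_gt0.
  nia.
have rows : (48 * N * 2 ^ k <= m)%N.
  have : (2 ^ k <= 2 ^ K)%N by rewrite leq_exp2l.
  move: (2 ^ k)%N (2 ^ K)%N Km => a b; nia.
have kNn : (k * N <= n)%N by nia.
have kp : (k%:R%:E <= p)%E by apply: le_trans Kp; rewrite lee_fin ler_nat.
apply: le_trans (vb_ge_block _ _ _ _ _ _ _ p2 pq k0 N0 kp kNn rows).
have : 0 < 48 * 2 * 2 * 96 * 2 :> R by lra.
set c0 := 48 * 2 * 2 * 96 * 2 => c0_gt0.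
rewrite invfM -[leLHS]mulrA ler_pM2l ?invr_gt0 // ler_pdivrMl // !mulrA ler_wpM2r ?powR_ge0 //.
rewrite -[leRHS]ger0_norm ?mulr_ge0 ?sqrtr_ge0 // -sqrtr_sqr; apply: ler_wsqrtr.
(* [K + 1 <= 192 * k] and [n <= 192 * k * N] multiply to [(K + 1) * n <= (192 * k)^2 * N]. *)
rewrite !exprMn sqr_sqrtr // -!natrX -!natrM ler_nat; nia.
Qed.

Theorem theorem6 (R : realType) :
  exists2 c : R, 0 < c &
    forall (m n : nat) (p q : \bar R),
      (0 < n)%N -> (n <= m)%N -> (m <= 2 ^ n)%N ->
      (2%:E <= p)%E -> (p <= q)%E ->
      c * (Num.sqrt (fine (Order.min p (ln (2 * m%:R / n%:R))%:E))
           * n%:R `^ (2^-1 - fine p^-1%E + fine q^-1%E))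
      <= vb n (lpball m p) (lpball m q).
Proof.
exists (48 * 2 * 2 * 96 * 2 * 192)^-1; first by rewrite invr_gt0.
move=> m n p q n0 nm mn p2 pq.
have [K [K0 Kp Km hL]] := exists_block_size _ _ _ _ n0 nm p2.
have [_ qp _ _] := fine_inv_bounds _ _ _ _ p2 pq Kp.
have nR : 0 < n%:R :> R by rewrite ltr0n.
set L := fine _ in hL *; set pe := fine p^-1%E in qp *; set qe := fine q^-1%E in qp *.
have -> : n%:R `^ (2^-1 - pe + qe) = Num.sqrt n%:R * n%:R `^ (qe - pe) :> R.
  rewrite -powR12_sqrt // -powRD ?(gt_eqF nR) ?implybT //; congr (_ `^ _); lra.
apply: (@le_trans _ _ ((48 * 2 * 2 * 96 * 2 * 192)^-1 *
    (Num.sqrt (K.+1%:R * n%:R) * n%:R `^ (qe - pe)))).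
  rewrite ler_pM2l ?invr_gt0 // mulrA ler_wpM2r ?powR_ge0 // sqrtrM //.
  by rewrite ler_wpM2r ?sqrtr_ge0 // ler_wsqrtr.
have [n96|n96] := leqP 96 n; first exact: vb_large.
(* For [n < 96] the left side is at most 1: [K <= n + 1 <= 96] gives [(K + 1) * n <= 98^2], and the
   power of [n] is at most 1. *)
apply: le_trans (vb_ge1 _ _ _ _ _ p2 (le_trans p2 pq) n0 (leq_trans n0 nm)).
have Kn : (K <= n.+1)%N.
  rewrite -(@leq_exp2l 2) // expnS; apply: leq_trans (leq_mul (leqnn 2) mn).
  by apply: leq_trans Km; rewrite leq_pmulr.
have h1 : Num.sqrt (K.+1%:R * n%:R) <= 98 :> R.
  rewrite -[leRHS]ger0_norm // -sqrtr_sqr; apply: ler_wsqrtr.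
  rewrite -natrM expr2 -natrM ler_nat; nia.
have h2 : n%:R `^ (qe - pe) <= 1 :> R.
  by rewrite -[leRHS](powRr0 n%:R) ler_powR ?ler1n // subr_le0.
rewrite ler_pdivrMl // mulr1.
apply: (@le_trans _ _ (98 * 1)); last by lra.
by apply: ler_pM; rewrite ?sqrtr_ge0 ?powR_ge0.
Qed.
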